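(* Let $0<\alpha<1$ and $p,q>0$. If $\lambda_1(\widetilde{SG}_{\alpha,p}(A,B))\le\lambda_1(\mathcal{A}_{\alpha,q}(A,B))$ holds for all positive definite $2\times2$ matrices $A,B$, then $q/p\ge1-\alpha$. Hence, if $\widetilde{SG}_{\alpha,p}(A,B)\prec_w\mathcal{A}_{\alpha,q}(A,B)$ for all positive definite $2\times2$ matrices $A,B$, then $q/p\ge1-\alpha$.
   Context: For positive definite $A,B$: $A\#_\alpha B:=A^{1/2}(A^{-1/2}BA^{-1/2})^\alpha A^{1/2}$; $\widetilde F_\alpha(A,B):=(A^{-1}\#_\alpha B)^{1/2}A^{2(1-\alpha)}(A^{-1}\#_\alpha B)^{1/2}$; $\widetilde{SG}_{\alpha,p}(A,B):=\widetilde F_\alpha(A^p,B^p)^{1/p}$; $\mathcal{A}_{\alpha,q}(A,B):=((1-\alpha)A^q+\alpha B^q)^{1/q}$. For an $n\times n$ positive semidefinite $X$, $\lambda_1(X)\ge\dots\ge\lambda_n(X)$ are its eigenvalues in decreasing order with multiplicities; $X\prec_wY$ means $\sum_{i=1}^k\lambda_i(X)\le\sum_{i=1}^k\lambda_i(Y)$ for $1\le k\le n$. *)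

(* Defs.v *)
(* R : realType, complex matrices over R[i] (mathcomp-real-closed),
   spectral decomposition from mathcomp/algebra/spectral.v, real powers powR
   from mathcomp-analysis. *)
From HB Require Import structures.
From mathcomp Require Import all_boot all_order all_algebra.
From mathcomp Require Import sesquilinear spectral.
From mathcomp Require Import complex.
From mathcomp Require Import reals exp.

Set Implicit Arguments.
Unset Strict Implicit.
Unset Printing Implicit Defensive.

Import Order.TTheory GRing.Theory Num.Theory.
Local Open Scope ring_scope.
Local Open Scope sesquilinear_scope.

Section MatrixMeans.
Variable R : realType.
Local Notation C := R[i].

(* positive definite (Hermitian, with positive quadratic form) n x n matrices *)
Definition posdefmx n (A : 'M[C]_n) : Prop :=
  A \is hermsymmx /\
  forall v : 'rV[C]_n, v != 0 -> 0 < (v *m A *m v ^t*) 0 0.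

(* real power of a positive definite matrix via its spectral decomposition
   A = P^-1 diag(d) P (P unitary): A^t := P^-1 diag(d^t) P *)
Definition mxpow n (A : 'M[C]_n) (t : R) : 'M[C]_n :=
  invmx (spectralmx A)
  *m diag_mx (map_mx (fun z : C => ((complex.Re z) `^ t)%:C%C) (spectral_diag A))
  *m spectralmx A.

(* eigenvalues (real, for Hermitian matrices) with multiplicities,
   in decreasing order; lambda k X is lambda_{k+1}(X) of the paper *)
Definition eigs n (X : 'M[C]_n) : seq R :=
  sort (fun x y : R => y <= x)
       [seq complex.Re (spectral_diag X 0 i) | i <- enum 'I_n].
Definition lambda n (k : nat) (X : 'M[C]_n) : R := nth 0 (eigs X) k.

(* weak majorization X <_w Y *)
Definition weakmaj n (X Y : 'M[C]_n) : Prop :=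
  forall k : nat, (1 <= k <= n)%N ->
    \sum_(i < k) lambda i X <= \sum_(i < k) lambda i Y.

(* weighted geometric mean A #_a B *)
Definition gmean n (a : R) (A B : 'M[C]_n) : 'M[C]_n :=
  mxpow A (2^-1) *m mxpow (mxpow A (- 2^-1) *m B *m mxpow A (- 2^-1)) a
  *m mxpow A (2^-1).

(* \widetilde F_a(A,B) *)
Definition Ftilde n (a : R) (A B : 'M[C]_n) : 'M[C]_n :=
  let G := gmean a (invmx A) B in
  mxpow G (2^-1) *m mxpow A (2 * (1 - a)) *m mxpow G (2^-1).

(* \widetilde{SG}_{a,p}(A,B) *)
Definition SGtilde n (a p : R) (A B : 'M[C]_n) : 'M[C]_n :=
  mxpow (Ftilde a (mxpow A p) (mxpow B p)) p^-1.

(* power mean \mathcal A_{a,q}(A,B) *)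
Definition Amean n (a q : R) (A B : 'M[C]_n) : 'M[C]_n :=
  mxpow ((1 - a)%:C%C *: mxpow A q + a%:C%C *: mxpow B q) q^-1.

End MatrixMeans.

(* Main.v *)
(* After replacing A^p, B^p by A, B and writing r = q/p, b = 1 - a, the hypothesis
   is lambda_1(F(A,B))^r <= lambda_1(b A^r + a B^r).  Test it on A = diag(1,e) and
   B = U^* diag(1,e) U, U the rotation with sin^2 = y, and let e -> 0: both become
   rank one projections.
   With G = A^-1 #_a B, the Rayleigh quotient of F at e_1 G^(1/2) gives
   lambda_1(F) >= G_11 = ((A^(1/2) B A^(1/2))^a)_11, and since d^a >= m^(a-1) d for
   0 < d <= m, with m the trace of A^(1/2) B A^(1/2), this is at least
   m^-b (1-y), which tends to (1-y)^a.  On the other side, the nonzero eigenvalues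
   w of the limit of b A^r + a B^r solve w (1-w) = ab y, so w <= 1 - ab y.
   Hence (1-y)^(ar) <= 1 - ab y, and letting y -> 0 yields r >= b. *)
Require Import Defs.
From HB Require Import structures.
From mathcomp Require Import all_boot all_order all_algebra.
From mathcomp Require Import sesquilinear spectral.
From mathcomp Require Import complex.
From mathcomp Require Import reals exp.
From mathcomp Require Import ring lra.
Import Order.TTheory GRing.Theory Num.Theory.
Local Open Scope ring_scope.
Local Open Scope sesquilinear_scope.

(** * Unitary diagonalization with real eigenvalues, and its functional calculus *)

Lemma conjC_real {R : realType} (x : R) : (x%:C%C)^* = x%:C%C.
Proof. exact: conjc_real. Qed.

Lemma adjmxM {C : numClosedFieldType} {m n p} (A : 'M[C]_(m, n)) (B : 'M_(n, p)) :
  (A *m B) ^t* = B ^t* *m A ^t*.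
Proof. by rewrite trmx_mul map_mxM. Qed.

Lemma hermsymmx_adj {C : numClosedFieldType} {n} (A : 'M[C]_n) :
  (A \is hermsymmx) = (A == A ^t*).
Proof. by rewrite qualifE /= expr0 scale1r. Qed.

(** [U] is meant to be any unitary matrix, not only the one chosen by [spectralmx], so that explicit
    diagonalizations can be used directly. With [d] real, functional calculus becomes [map_mx] on
    [d]. *)
Definition udiag {R : realType} {n} (U : 'M[R[i]]_n) (d : 'rV[R]_n) : 'M[R[i]]_n :=
  U ^t* *m diag_mx (map_mx (fun x : R => x%:C%C) d) *m U.

Lemma eq_conj_diag {C : numClosedFieldType} {n} (U : 'M[C]_n) (d e : 'rV_n) :
  d = e -> U ^t* *m diag_mx d *m U = U ^t* *m diag_mx e *m U.
Proof. by move=> ->. Qed.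

Section Udiag.
Variables (R : realType) (n : nat).
Implicit Types (U X : 'M[R[i]]_n) (d e : 'rV[R]_n).

Lemma adj_diag_real d :
  (diag_mx (map_mx (fun x : R => x%:C%C) d)) ^t* =
  diag_mx (map_mx (fun x : R => x%:C%C) d).
Proof.
rewrite tr_diag_mx; apply/matrixP => i j.
by rewrite !mxE rmorphMn /= conjC_real.
Qed.

Lemma hermsymmx_udiag U d : udiag U d \is hermsymmx.
Proof.
by rewrite hermsymmx_adj /udiag !adjmxM trmxCK adj_diag_real mulmxA.
Qed.

Lemma udiag_form U d (v w : 'rV_n) :
  (v *m udiag U d *m w ^t*) 0 0 =
  \sum_k (d 0 k)%:C%C * ((v *m U ^t*) 0 k * ((w *m U ^t*) 0 k)^*).
Proof.
have -> : v *m udiag U d *m w ^t* =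
  (v *m U ^t*) *m diag_mx (map_mx (fun x : R => x%:C%C) d) *m (w *m U ^t*) ^t*.
  by rewrite /udiag adjmxM trmxCK !mulmxA.
move: (v *m U ^t*) (w *m U ^t*) => {}v {}w.
rewrite mxE; apply: eq_bigr => k _; rewrite mul_mx_diag !mxE.
by rewrite [_ * (d 0 k)%:C%C]mulrC mulrA.
Qed.

Lemma udiag1 U : U \is unitarymx -> udiag U (const_mx 1) = 1%:M.
Proof.
move=> hU; rewrite /udiag map_const_mx diag_const_mx mulmx1.
by rewrite -(invmx_unitary hU) mulVmx ?unitarymx_unit.
Qed.

Lemma udiagM U d e : U \is unitarymx ->
  udiag U d *m udiag U e = udiag U (\row_k (d 0 k * e 0 k)).
Proof.
move=> hU; rewrite /udiag !mulmxA.
rewrite (mulmxtVK _ hU) -[X in X *m U = _]mulmxA mulmx_diag.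
apply: eq_conj_diag; apply/rowP => k; rewrite !mxE.
by rewrite rmorphM.
Qed.

Lemma udiag_spectral X : X \is hermsymmx ->
  X = udiag (spectralmx X) (map_mx (@complex.Re R) (spectral_diag X)).
Proof.
move=> hX; rewrite {1}(orthomx_spectralP (hermitian_normalmx hX)).
rewrite (invmx_unitary (spectral_unitarymx X)); apply: eq_conj_diag.
apply/rowP => k; rewrite !mxE RRe_real //.
exact: mxOverP (hermitian_spectral_diag_real hX) 0 k.
Qed.

(** With W = V U^*, the equality reads W diag(d) = diag(e) W; compare entries at i, j. *)
Lemma udiag_intertwine U V d e : U \is unitarymx -> V \is unitarymx ->
  udiag U d = udiag V e ->
  forall i j, (V *m U ^t*) i j != 0 -> d 0 j = e 0 i.
Proof.
move=> hU hV eUV i j.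
have : V *m udiag U d *m U ^t* = V *m udiag V e *m U ^t* by rewrite eUV.
rewrite /udiag !mulmxA (unitarymxP hV) mul1mx.
rewrite (mulmxtVK _ hU) => /matrixP /(_ i j).
rewrite -[in RHS]mulmxA mul_mx_diag mul_diag_mx !mxE => eq nz.
apply: complexI; apply: (mulfI nz); rewrite eq mulrC; congr (_ * _).
Qed.

Lemma unitarymx_adjl U : U \is unitarymx -> U ^t* *m U = 1%:M.
Proof.
by move=> hU; rewrite -(invmx_unitary hU) mulVmx ?unitarymx_unit.
Qed.

(** Where W_ij is nonzero, d_j = e_i and so f(d_j) = f(e_i); thus W = V U^* also intertwines the
    images under [f]. This lets [mxpow] be computed from any diagonalization. *)
Lemma udiag_map U V d e (f : R -> R) : U \is unitarymx -> V \is unitarymx ->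
  udiag U d = udiag V e -> udiag U (map_mx f d) = udiag V (map_mx f e).
Proof.
move=> hU hV eUV; have key := udiag_intertwine _ _ _ _ hU hV eUV.
set D := diag_mx (map_mx (fun x : R => x%:C%C) (map_mx f d)).
set E := diag_mx (map_mx (fun x : R => x%:C%C) (map_mx f e)).
have WD : V *m U ^t* *m D = E *m (V *m U ^t*).
  apply/matrixP => i j; move: (V *m U ^t*) key => W key.
  rewrite mul_mx_diag mul_diag_mx !mxE mulrC.
  have [->|nz] := eqVneq (W i j) 0; first by rewrite !mulr0.
  by rewrite (key _ _ nz).
rewrite /udiag -/D -/E -[LHS]mul1mx -(unitarymx_adjl _ hV).
have -> : V^t* *m V *m (U^t* *m D *m U) = V^t* *m (V *m U^t* *m D) *m U.
  by rewrite !mulmxA.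
by rewrite WD -!mulmxA (unitarymx_adjl _ hU) mulmx1.
Qed.

Lemma mxpow_udiag U d t : U \is unitarymx ->
  mxpow (udiag U d) t = udiag U (map_mx (fun x : R => x `^ t) d).
Proof.
move=> hU; have hX := hermsymmx_udiag U d.
set X := udiag U d in hX *.
have sU := spectral_unitarymx X.
rewrite (udiag_map _ _ _ _ (fun x : R => x `^ t) hU sU (udiag_spectral _ hX)) /mxpow.
rewrite (invmx_unitary sU); apply: eq_conj_diag.
by apply/rowP => k; rewrite !mxE.
Qed.

Lemma mulmx_adj_unitary_eq0 U (v : 'rV_n) : U \is unitarymx ->
  (v *m U ^t* == 0) = (v == 0).
Proof.
move=> hU; apply/eqP/eqP => [h|->]; last by rewrite mul0mx.
by rewrite -[v]mulmx1 -(unitarymx_adjl _ hU) mulmxA h mul0mx.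
Qed.

Lemma posdefmx_udiag U d : U \is unitarymx -> (forall k, 0 < d 0 k) ->
  posdefmx (udiag U d).
Proof.
move=> hU hd; split=> [|v]; first exact: hermsymmx_udiag.
rewrite -(mulmx_adj_unitary_eq0 _ _ hU) udiag_form => nz.
have ge0 k : 0 <= (d 0 k)%:C%C * ((v *m U ^t*) 0 k * ((v *m U ^t*) 0 k)^*).
  by rewrite mulr_ge0 ?mul_conjC_ge0 // ler0c ltW.
rewrite lt_neqAle sumr_ge0 // andbT eq_sym psumr_neq0 //.
have /rV0Pn [k hk] := nz; apply/hasP; exists k; rewrite ?mem_index_enum //=.
by rewrite mulr_gt0 ?mul_conjC_gt0 // ltcR.
Qed.

Lemma row_unitary_neq0 U k : U \is unitarymx -> row k U != 0.
Proof.
move=> hU; apply/eqP => row0; have := row_mul k U (U ^t*).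
rewrite row0 mul0mx (unitarymxP hU) => /rowP /(_ k).
by rewrite !mxE eqxx => /eqP; rewrite oner_eq0.
Qed.

Lemma row_unitary_form U (d : 'rV[R]_n) k : U \is unitarymx ->
  (row k U *m udiag U d *m (row k U) ^t*) 0 0 = (d 0 k)%:C%C.
Proof.
move=> hU; rewrite udiag_form -row_mul (unitarymxP hU).
rewrite (bigD1 k) //= big1 ?addr0 => [|i /negbTE nk].
  by rewrite !mxE eqxx conjC1 !mulr1.
by rewrite !mxE eq_sym nk mul0r mulr0.
Qed.

Lemma posdefmx_spectral X : posdefmx X ->
  exists2 U : 'M[R[i]]_n, U \is unitarymx &
    exists2 d : 'rV[R]_n, (forall k, 0 < d 0 k) & X = udiag U d.
Proof.
move=> [hX posX]; have hU := spectral_unitarymx X; exists (spectralmx X) => //.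
have eX := udiag_spectral _ hX; eexists; last exact: eX.
(* The k-th eigenvalue is the value of the form at the k-th row of the spectral matrix. *)
move=> k; rewrite -ltcR -(row_unitary_form _ _ k hU) -eX; apply: posX.
exact: row_unitary_neq0.
Qed.

Lemma posdefmx_pow X t : posdefmx X -> posdefmx (mxpow X t).
Proof.
move=> /posdefmx_spectral [U hU [d hd ->]]; rewrite mxpow_udiag //.
by apply: posdefmx_udiag => // k; rewrite mxE powR_gt0.
Qed.

Lemma mxpow_half X : posdefmx X -> mxpow X 2^-1 *m mxpow X 2^-1 = X.
Proof.
move=> /posdefmx_spectral [U hU [d hd ->]]; rewrite (mxpow_udiag _ _ _ hU).
rewrite (udiagM _ _ _ hU); congr udiag; apply/rowP => k.
rewrite !mxE powR12_sqrt ?ltW //.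
by rewrite -expr2 sqr_sqrtr ?ltW.
Qed.

Lemma posdefmx_congr X (S : 'M_n) : posdefmx X -> S \in unitmx ->
  posdefmx (S *m X *m S ^t*).
Proof.
move=> [hX posX] uS; split.
  by move: hX; rewrite !hermsymmx_adj !adjmxM trmxCK => /eqP <-; rewrite mulmxA.
move=> v nz; have := posX (v *m S); rewrite adjmxM !mulmxA; apply.
by apply: contra nz => /eqP h; rewrite -[v](mulmxK uS) h mul0mx.
Qed.

Lemma udiag_form_le U d (c : R) (v : 'rV_n) : U \is unitarymx ->
  (forall k, d 0 k <= c) ->
  (v *m udiag U d *m v ^t*) 0 0 <= c%:C%C * (v *m v ^t*) 0 0.
Proof.
(* With the identity written as a [udiag U], both sides are sums over the same coordinates and
   compare termwise. *)
move=> hU hd; have -> : v *m v ^t* = v *m udiag U (const_mx 1) *m v ^t*.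
  by rewrite udiag1 // mulmx1.
rewrite [leLHS]udiag_form [X in _ * X]udiag_form.
rewrite mulr_sumr; move: (v *m U ^t*) => {}v; apply: ler_sum => k _.
rewrite mxE mul1r.
by rewrite ler_wpM2r ?mul_conjC_ge0 // lecR.
Qed.

End Udiag.

(** * The largest eigenvalue, quadratic forms and diagonal entries *)

(** The head of a decreasingly sorted list is its maximum. Size [n.+1] keeps the list nonempty, so
    the default [0] of [nth] is never returned. *)
Lemma lambda0_le {R : realType} {n} (X : 'M[R[i]]_n.+1) (c : R) :
  lambda 0 X <= c <-> forall k, complex.Re (spectral_diag X 0 k) <= c.
Proof.
rewrite /lambda /eigs; set s := map _ _.
have tot : total (fun x y : R => y <= x) by move=> x y; exact: le_total.
have trs : transitive (fun x y : R => y <= x).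
  by move=> y x z xy yz; exact: le_trans yz xy.
have memk k : complex.Re (spectral_diag X 0 k) \in sort (fun x y : R => y <= x) s.
  by rewrite mem_sort; apply/mapP; exists k; rewrite ?mem_enum.
split=> [le k|le].
  apply: le_trans le; move: (memk k).
  have := sort_sorted tot s; case: (sort _ s) => //= a l; rewrite path_sortedE //.
  by case/andP => /allP all_a _; rewrite in_cons => /predU1P [->//|/all_a].
have : nth 0 (sort (fun x y : R => y <= x) s) 0 \in sort (fun x y : R => y <= x) s.
  by apply: mem_nth; rewrite size_sort size_map size_enum_ord.
by rewrite mem_sort => /mapP [k _ ->].
Qed.

(** Every row of the unitary transition matrix has a nonzero entry, so by [udiag_intertwine] each
    eigenvalue of one diagonalization occurs in the other. *)
Lemma lambda0_udiag_le {R : realType} {n} (U : 'M[R[i]]_n.+1) d (c : R) :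
  U \is unitarymx ->
  lambda 0 (udiag U d) <= c <-> forall k, d 0 k <= c.
Proof.
move=> hU; have hX := hermsymmx_udiag _ _ U d.
have eX := udiag_spectral _ _ _ hX; have hV := spectral_unitarymx (udiag U d).
have row_neq0 (V W : 'M[R[i]]_n.+1) i : V \is unitarymx -> W \is unitarymx ->
    exists j, (V *m W ^t*) i j != 0.
  move=> uV uW; have /rV0Pn [j hj] : row i (V *m W ^t*) != 0.
    have uW' : W ^t* \is unitarymx by rewrite trmxC_unitary.
    exact: row_unitary_neq0 _ _ _ i (mul_unitarymx uV uW').
  by exists j; move: hj; rewrite mxE.
rewrite lambda0_le; split=> le k.
  have [j hj] := row_neq0 _ _ k hU hV.
  have := udiag_intertwine _ _ _ _ _ _ hV hU (esym eX) _ _ hj.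
  by rewrite mxE => <-.
have [j hj] := row_neq0 _ _ k hV hU.
have := udiag_intertwine _ _ _ _ _ _ hU hV eX _ _ hj.
by rewrite mxE => <-.
Qed.

Lemma diag_entry_form {C : numClosedFieldType} {n} (X : 'M[C]_n) i :
  X i i = ((delta_mx 0 i : 'rV_n) *m X *m (delta_mx 0 i : 'rV_n) ^t*) 0 0.
Proof.
rewrite -rowE !mxE (bigD1 i) //= big1 ?addr0 => [|k /negbTE ki].
  by rewrite !mxE !eqxx conjC1 mulr1.
by rewrite !mxE ki andbF conjC0 mulr0.
Qed.

Lemma posdefmxD {R : realType} {n} (X Y : 'M[R[i]]_n) :
  posdefmx X -> posdefmx Y -> posdefmx (X + Y).
Proof.
move=> [hX pX] [hY pY]; split.
  move: hX hY; rewrite !hermsymmx_adj => /eqP eX /eqP eY.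
  by rewrite linearD map_mxD /= -eX -eY.
by move=> v nz; rewrite mulmxDr mulmxDl mxE addr_gt0 ?pX ?pY.
Qed.

Lemma posdefmxZ {R : realType} {n} (X : 'M[R[i]]_n) (a : R) :
  0 < a -> posdefmx X -> posdefmx (a%:C%C *: X).
Proof.
move=> a0 [hX pX]; split.
  move: hX; rewrite !hermsymmx_adj => /eqP eX.
  by rewrite linearZ map_mxZ /= conjC_real -eX.
by move=> v nz; rewrite -scalemxAr -scalemxAl mxE mulr_gt0 ?pX ?ltcR.
Qed.

(** Strict monotonicity of the power t > 0 on eigenvalues; it strips the outer exponents 1/p and 1/q
    of the two means. *)
Lemma lambda0_mxpow_le {R : realType} {n} (X : 'M[R[i]]_n.+1) (t c : R) :
  posdefmx X -> 0 < t -> 0 <= c ->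
  lambda 0 (mxpow X t) <= c `^ t <-> lambda 0 X <= c.
Proof.
move=> /posdefmx_spectral [U hU [d hd ->]] t0 c0.
rewrite mxpow_udiag // !lambda0_udiag_le //.
split=> le k; have := le k; rewrite mxE => {}le.
  rewrite leNgt; apply: contraTN le => lt; rewrite -ltNge.
  by rewrite gt0_ltr_powR // nnegrE ltW.
by rewrite ge0_ler_powR // ?nnegrE // ltW.
Qed.

Lemma form_le_lambda0 {R : realType} {n} (X : 'M[R[i]]_n.+1) (c : R) (v : 'rV_n.+1) :
  X \is hermsymmx -> lambda 0 X <= c ->
  (v *m X *m v ^t*) 0 0 <= c%:C%C * (v *m v ^t*) 0 0.
Proof.
move=> hX; rewrite {1 2}(udiag_spectral _ _ _ hX).
have hU := spectral_unitarymx X.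
by rewrite lambda0_udiag_le // => le; exact: udiag_form_le.
Qed.

(* The Rayleigh quotient of G^(1/2) D G^(1/2) at e_i G^(1/2) is
   sum_k d_k |G_ik|^2 / G_ii >= G_ii. *)
Lemma sandwich_ge {R : realType} {n} (G D : 'M[R[i]]_n.+1) (d : 'rV[R]_n.+1) c i :
  posdefmx G -> D = udiag 1%:M d -> (forall k, 0 <= d 0 k) -> d 0 i = 1 ->
  lambda 0 (mxpow G 2^-1 *m D *m mxpow G 2^-1) <= c ->
  G i i <= c%:C%C.
Proof.
move=> posG -> hd di; set S := mxpow G 2^-1 => le.
have [hS _] := posdefmx_pow _ _ G 2^-1 posG.
have hG := posG.1; move: hS hG; rewrite -/S !hermsymmx_adj => /eqP eS /eqP eG.
have SS : S *m S = G by exact: mxpow_half.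
clearbody S; have hF : S *m udiag 1%:M d *m S \is hermsymmx.
  have := hermsymmx_udiag _ _ (1%:M : 'M[R[i]]_n.+1) d.
  rewrite !hermsymmx_adj => /eqP eD.
  by rewrite (adjmxM (S *m _)) (adjmxM S) -eS -eD mulmxA.
pose E := delta_mx 0 i : 'rV[R[i]]_n.+1.
have := form_le_lambda0 _ _ (E *m S) hF le.
have -> : E *m S *m (E *m S) ^t* =
    E *m G *m E ^t*.
  by rewrite (adjmxM E) -eS -SS !mulmxA.
have -> : E *m S *m (S *m udiag 1%:M d *m S) *m (E *m S) ^t* =
    (row i G) *m udiag 1%:M d *m (row i G) ^t*.
  by rewrite rowE -/E -SS (adjmxM E S) (adjmxM E) (adjmxM S) -eS !mulmxA.
rewrite -diag_entry_form udiag_form trmx1 map_mx1 mulmx1.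
have Gi0 : 0 < G i i.
  rewrite diag_entry_form; apply: posG.2; apply/eqP => /matrixP /(_ 0 i).
  by rewrite !mxE !eqxx => /eqP; rewrite oner_eq0.
rewrite (bigD1 i) //= di mul1r mxE => le1.
rewrite -(ler_pM2r Gi0); apply: le_trans le1.
rewrite (CrealP (gtr0_real Gi0)) lerDl sumr_ge0 // => k _.
by rewrite mulr_ge0 ?mul_conjC_ge0 // ler0c.
Qed.

Lemma udiag_diag_entry {R : realType} {n} (U : 'M[R[i]]_n) (d : 'rV[R]_n) i :
  udiag U d i i = \sum_k (d 0 k)%:C%C * (U k i * (U k i)^*).
Proof.
rewrite diag_entry_form udiag_form; apply: eq_bigr => k _.
by rewrite -rowE !mxE conjCK [_^* * _]mulrC.
Qed.

Lemma tr_udiag {R : realType} {n} (U : 'M[R[i]]_n) (d : 'rV[R]_n) :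
  U \is unitarymx -> \tr (udiag U d) = (\sum_k d 0 k)%:C%C.
Proof.
move=> hU; rewrite /udiag -mulmxA mxtrace_mulC -mulmxA (unitarymxP hU) mulmx1.
by rewrite mxtrace_diag rmorph_sum; apply: eq_bigr => k _; rewrite mxE.
Qed.

(* Eigenvalues satisfy 0 < d <= tr M <= m, hence d^a >= m^(a-1) d as a < 1. *)
Lemma mxpow_entry_ge {R : realType} {n} (M : 'M[R[i]]_n) (a m : R) i :
  posdefmx M -> a < 1 -> \tr M <= m%:C%C ->
  (m `^ (a - 1))%:C%C * M i i <= mxpow M a i i.
Proof.
move=> /posdefmx_spectral [U hU [d hd ->]] a1.
rewrite mxpow_udiag // tr_udiag // lecR => tr_m.
rewrite !udiag_diag_entry mulr_sumr; apply: ler_sum => k _.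
rewrite mulrA ler_wpM2r ?mul_conjC_ge0 // mxE -rmorphM lecR /=.
have dm : d 0 k <= m.
  apply: le_trans tr_m; rewrite (bigD1 k) //= lerDl sumr_ge0 // => j _.
  exact: ltW.
have d0 := hd k; have m0 := lt_le_trans d0 dm.
have -> : d 0 k `^ a = d 0 k `^ (a - 1) * d 0 k.
  by rewrite -[X in _ * X](powRr1 (ltW d0)) -powRD ?subrK ?(gt_eqF d0) ?implybT.
rewrite ler_pM2r // -opprB !powRN lef_pV2 ?posrE ?powR_gt0 //.
by apply: ge0_ler_powR => //; rewrite ?nnegrE ?subr_ge0 ltW.
Qed.

(** Row k of [U] is a left eigenvector. In size 2 this yields the quadratic equation of an
    eigenvalue. *)
Lemma eigen_det {R : realType} {n} (U : 'M[R[i]]_n) (d : 'rV[R]_n) k :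
  U \is unitarymx -> \det (udiag U d - ((d 0 k)%:C%C)%:M) = 0.
Proof.
move=> hU; apply/eqP/det0P; exists (row k U).
  exact: row_unitary_neq0.
rewrite mulmxBr mul_mx_scalar -row_mul /udiag !mulmxA (unitarymxP hU) mul1mx.
by rewrite row_mul row_diag_mx -scalemxAl -rowE mxE subrr.
Qed.

(** * Inverses, sandwiches and geometric means of positive definite matrices *)

Lemma posdefmx_unit {R : realType} {n} (X : 'M[R[i]]_n) :
  posdefmx X -> X \in unitmx.
Proof.
move=> [_ posX]; rewrite unitmxE unitfE; apply/det0P => -[v nz vX].
by have := posX v nz; rewrite vX mul0mx mxE ltxx.
Qed.

(** [S] is Hermitian and invertible, so this is a congruence by [S]. *)
Lemma posdefmx_sandwich {R : realType} {n} (S X : 'M[R[i]]_n) :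
  posdefmx S -> posdefmx X -> posdefmx (S *m X *m S).
Proof.
move=> posS posX; have := posdefmx_congr _ _ X S posX (posdefmx_unit _ posS).
by have := posS.1; rewrite hermsymmx_adj => /eqP <-.
Qed.

Lemma invmx_udiag {R : realType} {n} (U : 'M[R[i]]_n) (d : 'rV[R]_n) :
  U \is unitarymx -> (forall k, d 0 k != 0) ->
  invmx (udiag U d) = udiag U (map_mx GRing.inv d).
Proof.
move=> hU nz; have inv1 : udiag U d *m udiag U (map_mx GRing.inv d) = 1%:M.
  rewrite udiagM // -(udiag1 _ _ _ hU); congr udiag.
  by apply/rowP => k; rewrite !mxE divff.
have [uX _] := mulmx1_unit inv1.
by rewrite -[RHS]mul1mx -(mulVmx uX) -mulmxA inv1 mulmx1.
Qed.

Lemma posdefmx_gmean {R : realType} {n} (a : R) (A B : 'M[R[i]]_n) :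
  posdefmx A -> posdefmx B -> posdefmx (gmean a A B).
Proof.
by move=> posA posB; apply: posdefmx_sandwich; first exact: posdefmx_pow;
  apply: posdefmx_pow; apply: posdefmx_sandwich; first exact: posdefmx_pow.
Qed.

Lemma gmean_sqrtE {R : realType} {n} (a : R) (A B P Q : 'M[R[i]]_n) :
  mxpow A 2^-1 = P -> mxpow A (- 2^-1) = Q ->
  gmean a A B = P *m mxpow (Q *m B *m Q) a *m P.
Proof. by move=> <- <-. Qed.

(** * Scalar inequalities *)

Lemma ln_le_subr1 {R : realType} (x : R) : 0 < x -> ln x <= x - 1.
Proof.
by move=> x0; rewrite -{1}[x](addrNK 1) addrC le_ln1Dx // ltrBrDl subrr.
Qed.

(** For x = eta^(1/p + 1/q), both x^p and x^q are powers of eta with exponent at least 1. *)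
Lemma small_powR {R : realType} (p q eta : R) :
  0 < p -> 0 < q -> 0 < eta -> eta < 1 ->
  exists x : R, [/\ 0 < x, x < 1, x `^ p <= eta & x `^ q <= eta].
Proof.
move=> p0 q0 eta0 eta1; exists (eta `^ (p^-1 + q^-1)).
have eta01 : 0 < eta <= 1 by rewrite eta0 ltW.
have pq0 : 0 < p^-1 + q^-1 by rewrite addr_gt0 ?invr_gt0.
split; first by rewrite powR_gt0.
- have := gt0_ltr_powR pq0 _ _ eta1; rewrite powR1; apply; rewrite nnegrE.
  + exact: ltW.
  + exact: ler01.
- rewrite -powRrM ge1r_powR // mulrDl mulVf ?gt_eqF //.
  by rewrite lerDl mulr_ge0 ?invr_ge0 ?ltW.
- rewrite -powRrM ge1r_powR // mulrDl mulVf ?gt_eqF //.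
  by rewrite lerDr mulr_ge0 ?invr_ge0 ?ltW.
Qed.

(** Take logarithms and linearize by ln u <= u - 1. In the application e = x^p and f = x^q are the
    small errors, and the hypothesis compares the bounds of the two largest eigenvalues. *)
Lemma log_comparison {R : realType} (a b r y e f : R) :
  0 < a -> 0 < b -> a + b = 1 -> 0 < r -> 0 < y -> y < 1 -> 0 < e -> 0 < f ->
  (1 - y) * (1 - y + 2 * e) `^ (- b) <= (1 - a * b * y + f) `^ r^-1 ->
  a * y * (b * (1 - y) - r) <= f + 2 * (r * b * e).
Proof.
move=> a0 b0 ab r0 y0 y1 e0 f0 le.
have ln_mul (u v : R) : 0 < u -> 0 < v -> ln (u * v) = ln u + ln v.
  exact: lnM.
have c0 : 0 < 1 - y by rewrite subr_gt0.
have ce0 : 0 < 1 - y + 2 * e by lra.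
have ab1 : a * b < 1 by nra.
have ab0 : 0 < a * b by exact: mulr_gt0.
have L0 : 0 < 1 - a * b * y + f by nra.
have pce0 := powR_gt0 (- b) ce0.
rewrite -ler_ln ?posrE ?(mulr_gt0 c0 pce0) ?(powR_gt0 _ L0) // in le.
move: le; rewrite ln_mul // !ln_powR ler_pdivlMl // => le.
have lnL := ln_le_subr1 _ L0.
(* Factoring out 1 - y lets the two logarithms combine into (1 - b) ln (1 - y) = a ln (1 - y). *)
have lnce : ln (1 - y + 2 * e) <= ln (1 - y) + 2 * e / (1 - y).
  have -> : 1 - y + 2 * e = (1 - y) * (1 + 2 * e / (1 - y)).
    by field; rewrite gt_eqF.
  have t0 : 0 < 2 * e / (1 - y) by rewrite divr_gt0 // mulr_gt0.
  rewrite ln_mul //; last by rewrite addr_gt0.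
  by rewrite lerD2l le_ln1Dx // (lt_trans _ t0) ?ltrN10.
(* ln u <= u - 1 at u = 1 / (1 - y). *)
have lnc : - ln (1 - y) <= y / (1 - y).
  rewrite -lnV ?posrE //; apply: le_trans (ln_le_subr1 _ _) _.
    by rewrite invr_gt0.
  by rewrite le_eqVlt; apply/orP; left; apply/eqP; field; rewrite gt_eqF.
have key : r * (- (a * (y / (1 - y))) - b * (2 * e / (1 - y))) <= f - a * b * y.
  apply: le_trans (_ : r * (ln (1 - y) + - b * ln (1 - y + 2 * e)) <= _); last lra.
  rewrite ler_pM2l //; nra.
(* Clear the denominator 1 - y; on the right, f (1 - y) <= f. *)
move: key; rewrite -(ler_pM2r c0).
have -> : r * (- (a * (y / (1 - y))) - b * (2 * e / (1 - y))) * (1 - y) =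
  - (r * a * y + 2 * r * b * e) by field; rewrite gt_eqF.
nra.
Qed.

(* For z = f + (1 - f) w the equation becomes w (1 - w) = a b s^2. *)
Lemma root_bound {R : realDomainType} (a b c s f z : R) :
  0 <= a -> 0 <= b -> a + b = 1 -> c ^+ 2 + s ^+ 2 = 1 -> 0 <= f -> f < 1 ->
  (b + a * (c ^+ 2 + f * s ^+ 2) - z) *
    (b * f + a * (s ^+ 2 + f * c ^+ 2) - z) = (a * ((1 - f) * (c * s))) ^+ 2 ->
  z <= 1 - a * b * s ^+ 2 + f.
Proof.
move=> a0 b0 ab cs f0 f1 eqz.
have s0 := sqr_ge0 s; have c0 := sqr_ge0 c.
have {eqz} eqw : (z - f) * (1 - z) = (1 - f) ^+ 2 * (a * b * s ^+ 2).
  have eb : b = 1 - a by lra.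
  have ec : c ^+ 2 = 1 - s ^+ 2 by lra.
  apply/esym/eqP; rewrite -subr_eq0; apply/eqP.
  rewrite !exprMn ec eb in eqz *.
  move/eqP: eqz; rewrite -subr_eq0 => /eqP <-; ring.
set P := a * b * s ^+ 2 in eqw *.
have P0 : 0 <= P by exact: mulr_ge0 (mulr_ge0 a0 b0) s0.
have Q0 : 0 <= (z - f) * (1 - z) by rewrite eqw mulr_ge0 ?sqr_ge0.
(* As f < 1, a nonnegative product (z - f)(1 - z) confines z to [f, 1]. *)
have z1 : z <= 1 by rewrite leNgt; apply/negP => zgt; nra.
have zf : f <= z by rewrite leNgt; apply/negP => zlt; nra.
(* From z - f <= 1 - f; cancelling 1 - f leaves (1 - f) P <= 1 - z, and P <= 1 then finishes. *)
have le1 : (1 - f) * ((1 - f) * P) <= (1 - f) * (1 - z).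
  by rewrite mulrA -expr2 -eqw ler_wpM2r ?subr_ge0 // lerB.
rewrite ler_pM2l ?subr_gt0 // in le1.
have P1 : P <= 1.
  have a1 : a <= 1 by lra.
  have b1 : b <= 1 by lra.
  have s1 : s ^+ 2 <= 1 by lra.
  exact: mulr_ile1 (mulr_ge0 a0 b0) s0 (mulr_ile1 a0 b0 a1 b1) s1.
nra.
Qed.

(** * Rotations and explicit 2 x 2 matrices *)

Definition row2 {R : realType} (e : R) : 'rV[R]_2 :=
  \row_j (if j == 0 then 1 else e).
Definition rot {R : realType} (c s : R) : 'M[R[i]]_2 :=
  \matrix_(i, j) (if i == j then c else if i == 0 then s else - s)%:C%C.
Definition symmx2 {R : realType} (a b d : R) : 'M[R[i]]_2 :=
  \matrix_(i, j) (if i == j then if i == 0 then a else d else b)%:C%C.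

Lemma eq_mx2 {T : Type} (X Y : 'M[T]_2) :
  X 0 0 = Y 0 0 -> X 0 1 = Y 0 1 -> X 1 0 = Y 1 0 -> X 1 1 = Y 1 1 -> X = Y.
Proof.
move=> e00 e01 e10 e11; apply/matrixP => i j.
have ord2 (k : 'I_2) : k = 0 \/ k = 1.
  by case: k => [[|[|//]] hk]; [left|right]; apply: val_inj.
by case: (ord2 i) => ->; case: (ord2 j) => ->.
Qed.

Lemma mulmx2E {T : pzSemiRingType} {m n} (X : 'M[T]_(m, 2)) (Y : 'M_(2, n)) i j :
  (X *m Y) i j = X i 0 * Y 0 j + X i 1 * Y 1 j.
Proof.
rewrite mxE big_ord_recl big_ord1; congr (_ * _ + X i _ * Y _ j); exact: val_inj.
Qed.

Lemma det_mx2 {T : comNzRingType} (X : 'M[T]_2) :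
  \det X = X 0 0 * X 1 1 - X 0 1 * X 1 0.
Proof.
rewrite (expand_det_row _ 0) big_ord_recl big_ord1 /cofactor !det_mx11 !mxE /=.
rewrite expr0 mul1r expr1 mulN1r mulrN.
by congr (_ * X _ _ - X _ _ * X _ _); apply: val_inj.
Qed.

Lemma rot_unitary {R : realType} (c s : R) :
  c ^+ 2 + s ^+ 2 = 1 -> rot c s \is unitarymx.
Proof.
move=> cs; apply/unitarymxP; apply: eq_mx2;
  rewrite mulmx2E !mxE /= !conjC_real -!rmorphM -rmorphD /= -?[1]/(1%:C)%C
  -?[0]/(0%:C)%C; congr (_%:C)%C; rewrite -?cs; ring.
Qed.

(** The diagonal test matrix is written with [rot 1 0], so that the same lemmas serve both test
    matrices. *)
Lemma rot10 {R : realType} : rot (1 : R) 0 = 1%:M.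
Proof. by apply: eq_mx2; rewrite !mxE //= oppr0. Qed.

Lemma udiag_rot {R : realType} (c s e : R) :
  udiag (rot c s) (row2 e) =
  symmx2 (c ^+ 2 + e * s ^+ 2) ((1 - e) * (c * s)) (s ^+ 2 + e * c ^+ 2).
Proof.
apply: eq_mx2; rewrite /udiag mulmx2E mul_mx_diag !mxE /= !conjC_real
  -!rmorphM -rmorphD /=; congr (_%:C)%C; ring.
Qed.

(** Since 1^t = 1, the family [row2] is stable under powers. *)
Lemma mxpow_rot {R : realType} (c s x t : R) : c ^+ 2 + s ^+ 2 = 1 ->
  mxpow (udiag (rot c s) (row2 x)) t = udiag (rot c s) (row2 (x `^ t)).
Proof.
move=> cs; rewrite (mxpow_udiag _ _ _ _ _ (rot_unitary _ _ cs)); congr udiag.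
by apply/rowP => k; rewrite !mxE; case: ifP => _ //; rewrite powR1.
Qed.

Lemma posdefmx_rot {R : realType} (c s x : R) : c ^+ 2 + s ^+ 2 = 1 -> 0 < x ->
  posdefmx (udiag (rot c s) (row2 x)).
Proof.
move=> cs x0; apply: posdefmx_udiag; first exact: rot_unitary.
by move=> k; rewrite mxE; case: ifP.
Qed.

(** * Bounds of the two largest eigenvalues at the test pair *)

Lemma lambda0_Amean_le {R : realType} (a c s x q : R) :
  0 < a -> a < 1 -> c ^+ 2 + s ^+ 2 = 1 -> 0 < x -> x < 1 -> 0 < q ->
  lambda 0 (Amean a q (udiag (rot 1 0) (row2 x)) (udiag (rot c s) (row2 x))) <=
    (1 - a * (1 - a) * s ^+ 2 + x `^ q) `^ q^-1.
Proof.
move=> a0 a1 cs x0 x1 q0.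
have cs10 : (1 : R) ^+ 2 + 0 ^+ 2 = 1 by rewrite expr1n expr0n addr0.
rewrite /Amean !mxpow_rot //.
set f := x `^ q; have f0 : 0 < f by exact: powR_gt0.
have f1 : f < 1.
  have := gt0_ltr_powR q0 _ _ x1; rewrite powR1; apply; rewrite nnegrE //.
  exact: ltW.
set Y := (X in mxpow X).
have posY : posdefmx Y.
  by apply: posdefmxD; apply: posdefmxZ; rewrite ?subr_gt0 //; exact: posdefmx_rot.
have c2 := sqr_ge0 c; have s2 := sqr_ge0 s.
(* Makes the base 1 - a (1 - a) s^2 + f nonnegative, as [lambda0_mxpow_le] requires. *)
have P1 : a * (1 - a) * s ^+ 2 <= 1.
  have aa0 : 0 <= a * (1 - a) by nra.
  have aa1 : a * (1 - a) <= 1 by apply: mulr_ile1; lra.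
  by apply: mulr_ile1 => //; lra.
rewrite lambda0_mxpow_le ?invr_gt0 //; last by lra.
have [U hU [d _ eY]] := posdefmx_spectral _ _ _ posY.
rewrite eY lambda0_udiag_le // => k.
(* The characteristic equation at z = d_k is the hypothesis of [root_bound]. *)
have := eigen_det U d k hU; rewrite -eY det_mx2 /Y !udiag_rot !mxE /=.
rewrite mulr1n mulr0n !subr0 -!rmorphM -!rmorphD -!rmorphB -!rmorphM -!rmorphB /=.
move=> /complexI eq0; apply: root_bound (ltW a0) _ _ cs (ltW f0) f1 _; [lra|lra|].
apply/eqP; rewrite -subr_eq0 -eq0; apply/eqP; ring.
Qed.

Lemma udiag_rot10 {R : realType} (d : 'rV[R]_2) :
  udiag (rot 1 0) d = diag_mx (map_mx (fun x : R => x%:C%C) d).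
Proof. by rewrite /udiag rot10 trmx1 map_mx1 mul1mx mulmx1. Qed.

Lemma diag_sandwich00 {R : realType} (t : R) (X : 'M[R[i]]_2) :
  let S := udiag (rot 1 0) (row2 t) in (S *m X *m S) 0 0 = X 0 0.
Proof.
by rewrite /= udiag_rot10 mul_mx_diag mul_diag_mx !mxE /= mul1r mulr1.
Qed.

Lemma diag_sandwich11 {R : realType} (t : R) (X : 'M[R[i]]_2) :
  let S := udiag (rot 1 0) (row2 t) in
  (S *m X *m S) 1 1 = (t ^+ 2)%:C%C * X 1 1.
Proof.
rewrite /= udiag_rot10 mul_mx_diag mul_diag_mx !mxE /=.
by rewrite mulrAC -rmorphM expr2.
Qed.

Lemma le_lambda0_SG {R : realType} (a c s x p l : R) :
  0 < a -> a < 1 -> c ^+ 2 + s ^+ 2 = 1 -> 0 < x -> x < 1 -> 0 < p -> 0 <= l ->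
  lambda 0 (SGtilde a p (udiag (rot 1 0) (row2 x)) (udiag (rot c s) (row2 x)))
    <= l `^ p^-1 ->
  c ^+ 2 * (c ^+ 2 + 2 * x `^ p) `^ (- (1 - a)) <= l.
Proof.
move=> a0 a1 cs x0 x1 p0 l0.
have cs10 : (1 : R) ^+ 2 + 0 ^+ 2 = 1 by rewrite expr1n expr0n addr0.
rewrite /SGtilde (mxpow_rot 1 0 x p cs10) (mxpow_rot c s x p cs).
set e := x `^ p; have e0 : 0 < e by exact: powR_gt0.
have e1 : e < 1.
  have := gt0_ltr_powR p0 _ _ x1; rewrite powR1; apply; rewrite nnegrE //.
  exact: ltW.
have inv_e : invmx (udiag (rot 1 0) (row2 e)) = udiag (rot 1 0) (row2 e^-1).
  rewrite (invmx_udiag _ _ (rot_unitary _ _ cs10)) => [|k]; last first.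
    by rewrite mxE; case: ifP => _; rewrite ?oner_eq0 ?gt_eqF.
  by congr udiag; apply/rowP => k; rewrite !mxE; case: ifP; rewrite ?invr1.
(* From here [A] is the inverse diag(1, 1/e), the first argument of the geometric mean. *)
rewrite /Ftilde inv_e; set A := udiag (rot 1 0) (row2 e^-1).
set B := udiag (rot c s) (row2 e).
have posA : posdefmx A by apply: posdefmx_rot; rewrite ?invr_gt0.
have posB : posdefmx B by exact: posdefmx_rot.
have posG := posdefmx_gmean a _ _ posA posB.
have posS := posdefmx_pow _ _ _ 2^-1 posG.
have posD := posdefmx_pow _ _ _ (2 * (1 - a)) (posdefmx_rot 1 0 e cs10 e0).
have posF := posdefmx_sandwich _ _ posS posD.
have ip0 : 0 < p^-1 by rewrite invr_gt0.
move=> /(lambda0_mxpow_le _ _ _ posF ip0 l0).1.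
have eD := mxpow_rot 1 0 e (2 * (1 - a)) cs10; rewrite [in RHS]rot10 in eD.
have row_ge0 k : 0 <= row2 (e `^ (2 * (1 - a))) 0 k.
  by rewrite mxE; case: ifP => _; rewrite ?ler01 ?powR_ge0.
have row_0 : row2 (e `^ (2 * (1 - a))) 0 0 = 1 by rewrite mxE.
move=> /(sandwich_ge _ _ _ _ 0 posG eD row_ge0 row_0).
have eP := mxpow_rot 1 0 e^-1 2^-1 cs10.
have eQ := mxpow_rot 1 0 e^-1 (- 2^-1) cs10.
(* The outer factors of the mean are diagonal with first entry 1, so they leave the entry at 0, 0
   unchanged. *)
rewrite (gmean_sqrtE _ _ _ _ _ eP eQ) diag_sandwich00.
set t := e^-1 `^ (- 2^-1).
have t2 : t ^+ 2 = e.
  rewrite /t powRN powR12_sqrt ?invr_ge0 ?ltW // exprVn sqr_sqrtr ?invrK //.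
  by rewrite invr_ge0 ltW.
set T := udiag (rot 1 0) (row2 t); set M := T *m B *m T.
have posM : posdefmx M.
  by apply: posdefmx_sandwich posB; apply: posdefmx_rot => //;
    rewrite powR_gt0 ?invr_gt0.
have s2 := sqr_ge0 s; have c2 := sqr_ge0 c.
have M00 : M 0 0 = (c ^+ 2 + e * s ^+ 2)%:C%C.
  by rewrite /M diag_sandwich00 /B udiag_rot mxE.
(* The terms besides c^2 are e (2 s^2 + e c^2) <= 2 e. *)
have trM : \tr M <= (c ^+ 2 + 2 * e)%:C%C.
  have -> : \tr M = M 0 0 + M 1 1.
    by rewrite /mxtrace big_ord_recl big_ord1; congr (_ + M _ _); exact: val_inj.
  rewrite M00 /M diag_sandwich11 /B udiag_rot mxE /= t2 -rmorphM -rmorphD lecR /=.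
  nra.
(* The bound is m^(a-1) [M 0 0] with m = c^2 + 2 e; then [M 0 0] is reduced to c^2. *)
move=> le; have := le_trans (mxpow_entry_ge _ _ _ 0 posM a1 trM) le.
rewrite M00 -rmorphM lecR opprB mulrC; apply: le_trans.
by rewrite ler_wpM2r ?powR_ge0 // lerDl mulr_ge0 // ltW.
Qed.

(** * Reduction to the largest eigenvalue, and the contradiction from q/p < 1 - alpha *)

Lemma weakmaj_lambda0 {R : realType} {n} (X Y : 'M[R[i]]_n.+1) :
  weakmaj X Y -> lambda 0 X <= lambda 0 Y.
Proof. by move=> /(_ 1%N isT); rewrite !big_ord1. Qed.

Theorem theorem4p35 (R : realType) (alpha p q : R) :
  0 < alpha -> alpha < 1 -> 0 < p -> 0 < q ->
  ((forall A B : 'M[R[i]]_2, posdefmx A -> posdefmx B ->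
      lambda 0 (SGtilde alpha p A B) <= lambda 0 (Amean alpha q A B)) ->
    1 - alpha <= q / p)
  /\
  ((forall A B : 'M[R[i]]_2, posdefmx A -> posdefmx B ->
      weakmaj (SGtilde alpha p A B) (Amean alpha q A B)) ->
    1 - alpha <= q / p).
Proof.
move=> a0 a1 p0 q0.
suff main : (forall A B : 'M[R[i]]_2, posdefmx A -> posdefmx B ->
      lambda 0 (SGtilde alpha p A B) <= lambda 0 (Amean alpha q A B)) ->
    1 - alpha <= q / p.
  split=> [|maj]; first exact: main.
  by apply: main => A B posA posB; exact: weakmaj_lambda0 (maj A B posA posB).
move=> le_lambda; rewrite leNgt; apply/negP => lt_r.
set r := q / p in lt_r; set b := 1 - alpha in lt_r.
have r0 : 0 < r by rewrite divr_gt0.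
have b0 : 0 < b by rewrite subr_gt0.
have b1 : b < 1 by rewrite /b; lra.
have ab : alpha + b = 1 by rewrite /b; ring.
(* Half of the value where b (1 - y) = r, so that b (1 - y) - r stays positive. *)
pose y := (1 - r / b) / 2.
have by_eq : b * (1 - y) - r = (b - r) / 2 by rewrite /y; field; rewrite gt_eqF.
have rb0 : 0 < r / b by rewrite divr_gt0.
have rb1 : r / b < 1 by rewrite ltr_pdivrMr // mul1r.
have y0 : 0 < y by rewrite /y; lra.
have y1 : y < 1 by rewrite /y; lra.
pose g := alpha * y * (b * (1 - y) - r).
have ay0 : 0 < alpha * y by rewrite mulr_gt0.
have ay1 : alpha * y < 1 by nra.
have g0 : 0 < g by rewrite /g by_eq; nra.
have g1 : g < 1 by rewrite /g by_eq; nra.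
(* With both errors at most g/4 and r b <= 1, [log_comparison] gives g <= 3g/4, contradicting g >
   0. *)
have [x [x0 x1 xp xq]] := small_powR p q (g / 4) p0 q0 ltac:(lra) ltac:(lra).
have cs : Num.sqrt (1 - y) ^+ 2 + Num.sqrt y ^+ 2 = 1.
  by rewrite !sqr_sqrtr ?subr_ge0 ?ltW // subrK.
have cs10 : (1 : R) ^+ 2 + 0 ^+ 2 = 1 by rewrite expr1n expr0n addr0.
have le := le_lambda _ _ (posdefmx_rot 1 0 x cs10 x0) (posdefmx_rot _ _ x cs x0).
have := le_trans le (lambda0_Amean_le _ _ _ _ _ a0 a1 cs x0 x1 q0).
rewrite sqr_sqrtr ?(ltW y0) // -/b.
(* This puts the right-hand side in the form l^(1/p) that [le_lambda0_SG] expects. *)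
have -> : q^-1 = r^-1 * p^-1 by rewrite /r; field; rewrite !gt_eqF.
rewrite powRrM => /(le_lambda0_SG _ _ _ _ _ _ a0 a1 cs x0 x1 p0 (powR_ge0 _ _)).
rewrite sqr_sqrtr ?subr_ge0 ?(ltW y1) // -/b => key.
have := log_comparison alpha b r y _ _ a0 b0 ab r0 y0 y1
  (powR_gt0 p x0) (powR_gt0 q x0) key.
have rb := mulr_ile1 (ltW r0) (ltW b0) (ltW (lt_trans lt_r b1)) (ltW b1).
have rbe : r * b * x `^ p <= x `^ p by rewrite ler_piMl ?powR_ge0.
suff absurd (u f e d : R) :
    0 < u -> f <= u / 4 -> e <= u / 4 -> d <= e -> u <= f + 2 * d -> False.
  by rewrite -/g; exact: absurd g0 xq xp rbe.
by clear; lra.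
Qed.
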